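(* Let $P_n$, $C_n$ denote the path and the cycle on $n$ vertices, and $K_{1,n}$ the star on $n+1$ vertices. Then: (i) for every $n\ge 4$, $\widetilde{D}(P_n,x)=x^{n-2}(x^2+nx+n-3)$; (ii) for every $n\ge 3$, $\widetilde{D}(C_n,x)=x^{n-2}(x^2+nx+n)$; (iii) for every integer $n\ge 1$, $\widetilde{D}(K_{1,n},x)=x^n(n+x+1)$. Here $\widetilde{D}$ denotes the outer-connected domination polynomial.
   Context: All graphs are finite, simple, and have nonempty vertex set. A set $S\subseteq V(G)$ is a dominating set of $G$ if every vertex of $V(G)\setminus S$ is adjacent to at least one vertex of $S$. A set $S\subseteq V(G)$ is an outer-connected dominating set (ocd-set) of $G$ if $S$ is a dominating set of $G$ and either $S=V(G)$ or the subgraph of $G$ induced by $V(G)\setminus S$ is connected. The outer-connected domination number $\widetilde{\gamma}_c(G)$ is the minimum cardinality of an ocd-set of $G$. Let $\widetilde{d}(G,i)$ be the number of ocd-sets of $G$ of cardinality $i$. The outer-connected domination polynomial of $G$ is $\widetilde{D}(G,x)=\sum_{i=\widetilde{\gamma}_c(G)}^{|V(G)|}\widetilde{d}(G,i)\,x^i$. *)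

(* Defs.v *)
From HB Require Import structures.
From mathcomp Require Import all_boot all_order all_algebra.

Set Implicit Arguments.
Unset Strict Implicit.
Unset Printing Implicit Defensive.

Import GRing.Theory.
Local Open Scope ring_scope.

(* Nonemptiness of the vertex set is not part of the structure: it holds for
   the path, cycle and star graphs below in the ranges of n of interest. *)
Record sgraph := SGraph {
  vertex :> finType;
  edge : rel vertex;
  edge_sym : symmetric edge;
  edge_irrefl : irreflexive edge
}.

Section Induced.
Variables (G : sgraph) (A : {set G}).

Definition induced_edge : rel {x : G | x \in A} :=
  [rel x y | edge (val x) (val y)].

Fact induced_sym : symmetric induced_edge.
Proof. by move=> x y; apply: edge_sym. Qed.

Fact induced_irrefl : irreflexive induced_edge.
Proof. by move=> x; apply: edge_irrefl. Qed.

Definition induced : sgraph := SGraph induced_sym induced_irrefl.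
End Induced.

(* Vacuously true on the empty graph, which never arises in [ocd]. *)
Definition connected (G : sgraph) : bool :=
  [forall x : G, forall y : G, connect (@edge G) x y].

Definition dominating (G : sgraph) (S : {set G}) : bool :=
  [forall x in ~: S, exists y in S, edge x y].

Definition ocd (G : sgraph) (S : {set G}) : bool :=
  dominating S && ((S == [set: G]) || connected (induced (~: S))).

Fact ocd_setT (G : sgraph) : ocd [set: G].
Proof.
by rewrite /ocd eqxx andbT; apply/forall_inP => x; rewrite setCT inE.
Qed.

(* By [ocd_setT], the minimum ranges over a nonempty family. *)
Definition ocd_number (G : sgraph) : nat :=
  #|[arg min_(S < [set: G] | ocd S) #|S|]|.

Definition ocd_count (G : sgraph) (i : nat) : nat :=
  #|[set S : {set G} | ocd S & #|S| == i]|.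

Definition ocd_poly (G : sgraph) : {poly int} :=
  \sum_(ocd_number G <= i < #|G|.+1) (ocd_count G i)%:R *: 'X^i.

Section Path.
Variable n : nat.

Definition path_edge : rel 'I_n := [rel i j : 'I_n | (i.+1 == j) || (j.+1 == i)].

Fact path_sym : symmetric path_edge.
Proof. by move=> i j; rewrite /path_edge /= orbC. Qed.

Fact path_irrefl : irreflexive path_edge.
Proof. by move=> i; rewrite /path_edge /= orbb gtn_eqF. Qed.

Definition path_graph : sgraph := SGraph path_sym path_irrefl.
End Path.

Section Cycle.
Variable n : nat.

(* [ordS] is the successor modulo n; the conjunct [i != j] only matters for
   n = 1, where it removes the loop. *)
Definition cycle_edge : rel 'I_n :=
  [rel i j | (i != j) && ((ordS i == j) || (ordS j == i))].

Fact cycle_sym : symmetric cycle_edge.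
Proof. by move=> i j; rewrite /cycle_edge /= eq_sym orbC. Qed.

Fact cycle_irrefl : irreflexive cycle_edge.
Proof. by move=> i; rewrite /cycle_edge /= eqxx. Qed.

Definition cycle_graph : sgraph := SGraph cycle_sym cycle_irrefl.
End Cycle.

Section CompleteBipartite.
Variables m n : nat.

Definition bipartite_edge : rel ('I_m + 'I_n)%type :=
  fun x y => match x, y with
             | inl _, inr _ | inr _, inl _ => true
             | _, _ => false
             end.

Fact bipartite_sym : symmetric bipartite_edge.
Proof. by move=> [i|i] [j|j]. Qed.

Fact bipartite_irrefl : irreflexive bipartite_edge.
Proof. by case. Qed.

Definition complete_bipartite : sgraph :=
  SGraph bipartite_sym bipartite_irrefl.
End CompleteBipartite.

Definition star_graph (n : nat) : sgraph := complete_bipartite 1 n.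

(* Main.v *)
(* Count ocd-sets through their complements A.  The empty set and, without
   isolated vertices, the singletons always qualify; in the three families no A
   with more than two vertices does.  The admissible pairs are the edges both of
   whose endpoints have a further neighbor: the n - 3 inner edges of the path,
   all n edges of the cycle, none in the star. *)

Require Import Defs.
From HB Require Import structures.
From mathcomp Require Import all_boot all_order all_algebra.
From mathcomp Require Import zify ring.

Set Implicit Arguments.
Unset Strict Implicit.
Unset Printing Implicit Defensive.

Import GRing.Theory.
Local Open Scope ring_scope.

(** * Complements of ocd-sets in a general graph *)

Lemma ocdC (G : sgraph) (A : {set G}) :
  ocd (~: A) = [forall x in A, exists y in ~: A, edge x y] &&
               ((A == set0) || connected (induced A)).
Proof.
rewrite /ocd /dominating setCK; congr (_ && (_ || _)).
by rewrite -(inj_eq (can_inj (@setCK G))) setCK setCT.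
Qed.

(** Membership in [B] propagates along any walk inside [A] starting at [x]. A small closed [B] thus
    bounds the size of a connected [A]. *)
Lemma connected_induced_sub (G : sgraph) (A B : {set G}) (x : G) :
  connected (induced A) -> x \in A -> x \in B ->
  (forall y z, y \in B -> y \in A -> z \in A -> edge y z -> z \in B) ->
  A \subset B.
Proof.
move=> /forallP cA xA xB clB; apply/subsetP => y yA.
have /forallP/(_ (exist _ y yA))/connectP[p] := cA (exist _ x xA).
elim: p x xA xB => [|[z zA] p IHp] x xA xB /= => [_ [->] //|/andP[xz pp] eqy].
exact: (IHp z zA (clB x z xB xA zA xz)).
Qed.

Lemma connected_induced1 (G : sgraph) (x : G) : connected (induced [set x]).
Proof.
apply/forallP => -[y yx]; apply/forallP => -[z zx].
suff -> : exist _ y yx = exist _ z zx :> induced [set x] by apply: connect0.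
by apply: val_inj => /=; move: (yx) (zx); rewrite !inE => /eqP-> /eqP->.
Qed.

Lemma connected_induced2 (G : sgraph) (x y : G) :
  edge x y -> connected (induced [set x; y]).
Proof.
move=> xy; apply/forallP => -[a aA]; apply/forallP => -[b bA].
have [eab|neq_ab] := eqVneq a b.
  suff -> : exist _ a aA = exist _ b bA :> induced [set x; y].
    exact: connect0.
  exact: val_inj.
apply: connect1; rewrite /= /induced_edge /=.
move: (aA) (bA) neq_ab; rewrite !inE.
by move=> /orP[]/eqP-> /orP[]/eqP->; rewrite ?eqxx // edge_sym.
Qed.

(** If [x] had no neighbor in [A], then [[set x]] would be closed under adjacency in [A] and so
    contain [A]. *)
Lemma connected_induced_neighbor (G : sgraph) (A : {set G}) (x : G) :
  connected (induced A) -> x \in A -> (1 < #|A|)%N ->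
  exists2 y, y \in A & edge x y.
Proof.
move=> cA xA A_gt1; apply/exists_inP; apply: contraTT A_gt1.
rewrite negb_exists_in -leqNgt => /forall_inP nx.
rewrite -(cards1 x); apply/subset_leq_card.
apply: (connected_induced_sub cA xA) => [|y z]; first exact: set11.
by rewrite inE => /eqP-> _ /nx/negPf->.
Qed.

Lemma ocdC_set0 (G : sgraph) : ocd (~: (set0 : {set G})).
Proof. by rewrite setC0 ocd_setT. Qed.

Lemma ocdC_set1 (G : sgraph) (x y : G) : edge x y -> ocd (~: [set x]).
Proof.
move=> xy; rewrite ocdC connected_induced1 orbT andbT.
apply/forall_inP => z; rewrite inE => /eqP->; apply/exists_inP; exists y => //.
by rewrite !inE; apply: contraTneq xy => ->; rewrite edge_irrefl.
Qed.

(** Connectivity of the pair forces the edge; domination gives each endpoint a neighbor outside the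
    pair, which by irreflexivity just means one other than its partner. *)
Lemma ocdC_set2P (G : sgraph) (x y : G) : x != y ->
  reflect [/\ edge x y, exists2 z, z != y & edge x z
                      & exists2 z, z != x & edge y z]
          (ocd (~: [set x; y])).
Proof.
move=> neq_xy; rewrite ocdC; apply: (iffP andP).
  case=> /forall_inP dom /orP[/eqP/setP/(_ x)|conn]; first by rewrite !inE eqxx.
  have [|z zA xz] := connected_induced_neighbor conn (set21 x y).
    by rewrite cards2 neq_xy.
  have xy : edge x y.
    by move: zA xz; rewrite !inE => /orP[]/eqP-> //; rewrite edge_irrefl.
  split=> //.
    have /exists_inP[u] := dom x (set21 x y).
    by rewrite !inE negb_or => /andP[_ uy] xu; exists u.
  have /exists_inP[u] := dom y (set22 x y).
  by rewrite !inE negb_or => /andP[ux _] yu; exists u.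
case=> xy [u uy xu] [v vx yv]; split; last by rewrite connected_induced2 ?orbT.
apply/forall_inP => z; rewrite !inE => /orP[]/eqP->; apply/exists_inP.
  exists u => //; rewrite !inE negb_or uy andbT.
  by apply: contraTneq xu => ->; rewrite edge_irrefl.
exists v => //; rewrite !inE negb_or vx.
by apply: contraTneq yv => ->; rewrite edge_irrefl.
Qed.

(* Each vertex outside S has one neighbor in S, hence at most one outside S;
   and a connected graph of maximum degree 1 has at most two vertices. *)
Lemma card_ocdC_le2 (G : sgraph) :
  (forall x : G, #|[set y | edge x y]| <= 2)%N ->
  forall A : {set G}, ocd (~: A) -> (#|A| <= 2)%N.
Proof.
move=> deg A; rewrite ocdC => /andP[/forall_inP dom].
case/orP=> [/eqP->|conn]; first by rewrite cards0.
rewrite leqNgt; apply/negP => A_gt2.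
have A_gt1 : (1 < #|A|)%N by apply: leq_trans A_gt2.
have uniq_nbr x y z : x \in A -> y \in A -> z \in A -> edge x y -> edge x z ->
    z = y.
  move=> xA yA zA xy xz; apply/eqP/negPn/negP => neq_zy.
  have /exists_inP[w wA xw] := dom x xA; rewrite inE in wA.
  have := deg x; rewrite leqNgt => /negP[].
  have sub : w |: [set z; y] \subset [set y | edge x y].
    by apply/subsetP => u; rewrite !inE => /or3P[]/eqP->.
  apply: leq_trans (subset_leq_card sub).
  rewrite cardsU1 cards2 neq_zy !inE negb_or.
  by rewrite !(contraNneq _ wA) // => ->.
have /card_gt0P[x xA] : (0 < #|A|)%N by apply: leq_trans A_gt1.
have [y yA xy] := connected_induced_neighbor conn xA A_gt1.
move: A_gt2; rewrite ltnNge => /negP[].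
(* By [uniq_nbr], [x] and [y] are each other's only neighbors in [A], so the pair is closed under
   adjacency there. *)
apply: (@leq_trans #|[set x; y]|); last by rewrite cards2; case: eqP.
apply/subset_leq_card/(connected_induced_sub conn xA).
  exact: set21.
move=> u v; rewrite !inE => /orP[]/eqP-> uA vA uv; apply/orP.
  by right; apply/eqP/(uniq_nbr x).
by left; apply/eqP/(uniq_nbr y) => //; rewrite edge_sym.
Qed.

(** * The polynomial in terms of complement counts *)

Lemma ocd_polyE (G : sgraph) :
  ocd_poly G = \sum_(i < #|G|.+1) (ocd_count G i)%:R *: 'X^i.
Proof.
rewrite -(big_mkord xpredT (fun i => (ocd_count G i)%:R *: 'X^i)).
have leN : (ocd_number G <= #|G|.+1)%N by rewrite ltnW // ltnS max_card.
rewrite (big_cat_nat (leq0n _) leN) //= [X in _ = X + _]big1_seq ?add0r //.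
move=> i; rewrite mem_index_iota => /andP[_ /andP[_ lti]].
(* By minimality of [ocd_number], the coefficients added below it vanish. *)
suff -> : ocd_count G i = 0%N by rewrite scale0r.
apply/eqP; rewrite cards_eq0; apply/eqP/setP => S; rewrite !inE.
apply/negP => /andP[ocdS /eqP cardS]; move: lti.
rewrite /ocd_number; case: arg_minnP => [|T _ /(_ S ocdS)].
  exact: ocd_setT.
by rewrite cardS leqNgt => /negbTE->.
Qed.

Definition ocdC_sets (G : sgraph) (k : nat) : {set {set G}} :=
  [set A : {set G} | ocd (~: A) & #|A| == k].

Lemma ocd_countC (G : sgraph) (k : nat) :
  (k <= #|G|)%N -> ocd_count G (#|G| - k) = #|ocdC_sets G k|.
Proof.
move=> lek; rewrite -(card_imset _ (can_inj (@setCK G))).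
apply: eq_card => S; rewrite inE.
rewrite -[S in RHS]setCK (mem_imset _ _ (can_inj (@setCK G))) inE setCK.
congr (_ && _); have := cardsC S; lia.
Qed.

(** Only complements of size 0, 1 and 2 contribute. The first two counts are 1 and [#|G|], so each
    family reduces to counting admissible pairs. *)
Lemma ocd_poly_low (G : sgraph) :
  (1 < #|G|)%N -> (forall x : G, exists y, edge x y) ->
  (forall A : {set G}, ocd (~: A) -> (#|A| <= 2)%N) ->
  ocd_poly G = 'X^(#|G| - 2) *
    ('X^2 + #|G|%:R * 'X + #|ocdC_sets G 2|%:R).
Proof.
move=> G_gt1 noiso small.
have c0 : ocd_count G (#|G| - 0) = 1%N.
  rewrite ocd_countC // -(cards1 (set0 : {set G})).
  apply: eq_card => A; rewrite !inE cards_eq0.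
  by case: eqP => [->|_]; rewrite ?ocdC_set0 ?andbF.
have c1 : ocd_count G (#|G| - 1) = #|G|.
  rewrite ocd_countC ?(ltnW G_gt1) // -[RHS](card_imset _ (@set1_inj G)).
  apply: eq_card => A; rewrite inE; apply/andP/imsetP.
    by case=> _ /cards1P[x ->]; exists x.
  case=> x _ ->; rewrite cards1; split=> //.
  by have [y xy] := noiso x; apply: ocdC_set1 xy.
have c2 := ocd_countC G_gt1.
(* Reversing the summation makes the index the size of the complement. *)
rewrite ocd_polyE (reindex_inj rev_ord_inj) /=.
have big0 k : (2 < k <= #|G|)%N -> ocd_count G (#|G| - k) = 0%N.
  case/andP=> gtk lek; rewrite ocd_countC //; apply/eqP; rewrite cards_eq0.
  apply/eqP/setP => A; rewrite !inE; apply/negP => /andP[/small le2 /eqP ek].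
  by move: gtk; rewrite ltnNge -ek le2.
move: c0 c1 c2 big0; case: #|G| G_gt1 => [|[|m]] // _ c0 c1 c2 big0.
rewrite !big_ord_recl /= big1 ?addr0 => [|i _]; last first.
  by rewrite subSS big0 ?scale0r //= /bump /=; have := ltn_ord i; lia.
rewrite /bump /= !subSS subn0 in c0 c1 c2 *.
rewrite c0 c1 c2 !scaler_nat !subn0 mulr1n.
rewrite -(mulr_natl 'X^(m.+1)) -(mulr_natl 'X^m).
move: (m.+2%:R) (#|_|%:R) => a b; rewrite !exprS; ring.
Qed.

(** * Paths *)

Lemma path_edgeE (n : nat) (x y : path_graph n) :
  edge x y = (x.+1 == y :> nat) || (y.+1 == x :> nat).
Proof. by []. Qed.

Lemma path_deg_le2 (n : nat) (x : path_graph n) :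
  (#|[set y | edge x y]| <= 2)%N.
Proof.
case: n x => [[]//|n] x.
(* At an end of the path, truncation or the default of [inord] may add a non-neighbor; only
   inclusion matters here. *)
apply: (@leq_trans #|[set inord x.-1; inord x.+1 : 'I_n.+1]|); last first.
  by rewrite cards2; case: eqP.
apply/subset_leq_card/subsetP => y; rewrite !inE /= => /orP[]/eqP e.
  by rewrite e inord_val eqxx orbT.
by rewrite -e inord_val eqxx.
Qed.

Lemma path_ocdC2 (n : nat) :
  (4 <= n)%N -> #|ocdC_sets (path_graph n) 2| = (n - 3)%N.
Proof.
case: n => [|[|[|[|n]]]] // _; rewrite !subSS subn0 -[RHS]card_ord.
(* The shift by one skips the end edge at 0; as [i <= n], the upper endpoint stays below the last
   vertex [n.+3]. *)
pose f (i : 'I_n.+1) : {set path_graph n.+4} :=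
  [set inord i.+1; inord i.+2].
have vS (i : 'I_n.+1) : @inord n.+3 i.+1 = i.+1 :> nat.
  by rewrite inordK //; have := ltn_ord i; lia.
have vSS (i : 'I_n.+1) : @inord n.+3 i.+2 = i.+2 :> nat.
  by rewrite inordK //; have := ltn_ord i; lia.
have inj_f : injective f.
  move=> i j /setP fij; apply: val_inj => /=.
  (* Each lower endpoint lies in the other pair, so neither index exceeds the other. *)
  have := fij (inord i.+1); have := fij (inord j.+1).
  by rewrite !inE -!val_eqE /= !vS !vSS; lia.
rewrite -(card_imset _ inj_f); apply: eq_card => A; rewrite inE.
apply/andP/imsetP => [[ocdA cardA]|[i _ ->]].
  have fwd (x y : path_graph n.+4) : x.+1 = y :> nat ->
      ocd (~: [set x; y]) -> exists2 i, i \in 'I_n.+1 & [set x; y] = f i.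
    move=> exy /ocdC_set2P[]; first by rewrite -val_eqE /=; lia.
    move=> _ [u uy xu] [v vx yv].
    (* The further neighbor [v] of [y] must be [x + 2], which bounds [x] above; likewise [u] must be
       [x - 1], which makes [x] positive. *)
    have lti : (x.-1 < n.+1)%N.
      move: uy vx xu yv; rewrite !path_edgeE -!val_eqE /=.
      by have := ltn_ord v; lia.
    have x_gt0 : (0 < x)%N by move: uy xu; rewrite path_edgeE -val_eqE /=; lia.
    exists (Ordinal lti) => //; rewrite /f /= prednK //.
    by rewrite inord_val exy inord_val.
  have /cards2P[x [y [neq_xy eA]]] := cardA; rewrite {}eA in ocdA *.
  have /(ocdC_set2P neq_xy)[xy _ _] := ocdA.
  move: xy => /orP[]/eqP e; first exact: fwd.
  by rewrite setUC in ocdA *; apply: fwd.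
have neq : inord i.+1 != inord i.+2 :> path_graph n.+4.
  by rewrite -val_eqE /= vS vSS; lia.
split; last by rewrite cards2 neq.
(* The further neighbors of the two endpoints are [i] and [i.+3]. *)
have v3 : @inord n.+3 i.+3 = i.+3 :> nat.
  by rewrite inordK //; have := ltn_ord i; lia.
have v0 : @inord n.+3 i = i :> nat by rewrite inordK //; have := ltn_ord i; lia.
apply/ocdC_set2P => //; split.
- by rewrite path_edgeE vS vSS eqxx.
- by exists (inord i); rewrite ?path_edgeE -?val_eqE /= v0 ?vS ?vSS; lia.
- by exists (inord i.+3); rewrite ?path_edgeE -?val_eqE /= v3 ?vS ?vSS; lia.
Qed.

(** * Cycles *)

Lemma cycle_deg_le2 (n : nat) (x : cycle_graph n) :
  (#|[set y | edge x y]| <= 2)%N.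
Proof.
apply: (@leq_trans #|[set ordS x; ord_pred x]|); last first.
  by rewrite cards2; case: eqP.
apply/subset_leq_card/subsetP => y; rewrite !inE /= => /andP[_].
by case/orP => /eqP <-; rewrite ?ordSK eqxx ?orbT.
Qed.

Lemma ordS_neq (n : nat) (x : 'I_n) : (1 < n)%N -> ordS x != x.
Proof.
move=> n_gt1; rewrite -val_eqE /=; have := ltn_ord x.
by rewrite leq_eqVlt => /predU1P[e|/modn_small->]; rewrite ?e ?modnn; lia.
Qed.

(** Two steps return to the start only if [n] divides 2; the wrap-around cases are [x = n - 1] and
    [x = n - 2]. *)
Lemma ordSS_neq (n : nat) (x : 'I_n) : (2 < n)%N -> ordS (ordS x) != x.
Proof.
move=> n_gt2; rewrite -val_eqE /= -addn1 modnDml addn1; have := ltn_ord x.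
rewrite leq_eqVlt => /predU1P[e|].
  by rewrite -addn1 e modnDl modn_small; lia.
by rewrite leq_eqVlt => /predU1P[e|/modn_small->]; rewrite ?e ?modnn; lia.
Qed.

Lemma cycle_edge_ordS (n : nat) (x : cycle_graph n) :
  (1 < n)%N -> edge x (ordS x : cycle_graph n).
Proof. by move=> n_gt1; rewrite /= /cycle_edge /= eqxx eq_sym ordS_neq. Qed.

Lemma cycle_ocdC2 (n : nat) :
  (3 <= n)%N -> #|ocdC_sets (cycle_graph n) 2| = n.
Proof.
move=> n_gt2; have n_gt1 : (1 < n)%N by apply: ltnW.
rewrite -[RHS]card_ord.
pose f (i : 'I_n) : {set cycle_graph n} := [set i; ordS i].
have inj_f : injective f.
  (* Distinct [i] and [j] with the same pair would be each other's successors, contradicting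
     [ordSS_neq]. *)
  move=> i j fij; have := set21 i (ordS i); have := set21 j (ordS j).
  rewrite -[[set j; _]]fij [[set i; _]]fij.
  move=> /set2P[->//|ej] /set2P[->//|ei].
  by have := ordSS_neq i n_gt2; rewrite -ej -ei eqxx.
rewrite -(card_imset _ inj_f); apply: eq_card => A; rewrite inE.
apply/andP/imsetP => [[ocdA cardA]|[i _ ->]].
  have /cards2P[x [y [neq_xy eA]]] := cardA; rewrite {}eA in ocdA *.
  have /(ocdC_set2P neq_xy)[/andP[_ xy] _ _] := ocdA.
  case/orP: xy => /eqP <-; first by exists x.
  by exists y; rewrite // setUC.
have neq : i != ordS i :> cycle_graph n by rewrite eq_sym ordS_neq.
split; last by rewrite cards2 neq.
apply/ocdC_set2P => //; split.
- exact: cycle_edge_ordS.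
(* The outside neighbors are the vertices just before and just after the edge; they coincide when
   [n = 3]. *)
- exists (ord_pred i); last first.
    by rewrite edge_sym -{2}[i]ord_predK cycle_edge_ordS.
  by rewrite eq_sym -{1}[i]ord_predK ordSS_neq.
- exists (ordS (ordS i)); first exact: ordSS_neq.
  exact: cycle_edge_ordS.
Qed.

(** * Stars *)

(* A connected set with two or more vertices contains a leaf and the center,
   and then that leaf has no neighbor outside it. *)
Lemma star_ocdC_le1 (n : nat) (A : {set star_graph n}) :
  ocd (~: A) -> (#|A| <= 1)%N.
Proof.
rewrite ocdC => /andP[/forall_inP dom].
case/orP=> [/eqP->|conn]; first by rewrite cards0.
rewrite leqNgt; apply/negP => A_gt1.
have [i iA] : exists i, inr i \in A.
  have /card_gt0P[[x|i] xA] : (0 < #|A|)%N by apply: ltnW.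
    by have [[//|i] iA _] := connected_induced_neighbor conn xA A_gt1; exists i.
  by exists i.
have [[y|//] yA _] := connected_induced_neighbor conn iA A_gt1.
have /exists_inP[[z|//]] := dom _ iA.
by rewrite inE (ord1 z) -(ord1 y) yA.
Qed.

Theorem theorem5 :
  (forall n : nat, (4 <= n)%N ->
     ocd_poly (path_graph n) =
       'X^(n - 2) * ('X^2 + n%:R * 'X + n%:R - 3%:R)) /\
  (forall n : nat, (3 <= n)%N ->
     ocd_poly (cycle_graph n) =
       'X^(n - 2) * ('X^2 + n%:R * 'X + n%:R)) /\
  (forall n : nat, (1 <= n)%N ->
     ocd_poly (star_graph n) = 'X^n * (n%:R + 'X + 1)).
Proof.
split; [|split] => n n_ge.
- have n_gt1 : (1 < n)%N by apply: leq_trans n_ge.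
  rewrite ocd_poly_low ?card_ord //.
  + by rewrite path_ocdC2 // natrB ?addrA // ltnW.
  + case: n n_ge n_gt1 => [|[|n]] // _ _ x.
    have [x0|x_gt0] := posnP x.
      by exists (inord 1); rewrite path_edgeE inordK // x0.
    exists (inord x.-1); rewrite path_edgeE inordK; last first.
      by have := ltn_ord x; lia.
    by rewrite prednK ?eqxx ?orbT.
  + exact/card_ocdC_le2/path_deg_le2.
- have n_gt1 : (1 < n)%N by apply: leq_trans n_ge.
  rewrite ocd_poly_low ?card_ord //.
  + by rewrite cycle_ocdC2.
  + by move=> x; exists (ordS x); apply: cycle_edge_ordS.
  + exact/card_ocdC_le2/cycle_deg_le2.
- have c2 : #|ocdC_sets (star_graph n) 2| = 0%N.
    apply/eqP; rewrite cards_eq0; apply/eqP/setP => A; rewrite !inE.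
    by apply/negP => /andP[/star_ocdC_le1 A_le1 /eqP cardA];
      rewrite cardA in A_le1.
  rewrite ocd_poly_low ?card_sum ?card_ord //.
  (* With [n + 1] vertices and no admissible pair, the bracket is [X^2 + (n + 1) X]; its factor [X]
     raises [X^(n - 1)] to [X^n]. *)
  + case: n n_ge c2 => // n _ ->; rewrite add1n !subSS subn0 !exprS.
    by rewrite -(natr1 n.+1); move: (n.+1%:R) => a; ring.
  + by case=> [i|i]; [exists (inr (Ordinal n_ge)) | exists (inl ord0)].
  + by move=> A /star_ocdC_le1/leq_trans; apply.
Qed.
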